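(* Consider the $D_4^{(1)}$ system (defined in the context) restricted to parameters with $\alpha_4=\alpha_1$ and $\alpha_0=\alpha_3$, and set $\beta_0:=\alpha_3$, $\beta_1:=\alpha_2$, $\beta_2:=\alpha_1$, so that $\beta_0+\beta_1+\beta_2=\frac12$. This system has the following invariant divisors: if $\beta_0=0$, then $f_0:=(x-\eta)(y-1)$ is an invariant divisor; if $\beta_1=0$, then $f_1:=z$ is; if $\beta_2=0$, then $f_2:=xy$ is.
   Context: A polynomial $f$ in $x,y,z$ is an invariant divisor of a polynomial system if the derivative $df/dt$ along the system equals $f$ times a polynomial in $x,y,z$ (with coefficients in $\mathbb{C}(t)$). The $D_4^{(1)}$ system. Let $\eta\in\mathbb{C}\setminus\{0\}$, let $b(t)\in\mathbb{C}(t)$ be nonzero, and let $\alpha_0,\dots,\alpha_4\in\mathbb{C}$ satisfy $\alpha_0+\alpha_1+2\alpha_2+\alpha_3+\alpha_4=1$. The $D_4^{(1)}$ system for unknown functions $x,y,z$ of $t$ is $$\frac{2\eta}{b(t)}\frac{dx}{dt}=P,\qquad -\frac{2\eta}{b(t)}\frac{dy}{dt}=Q,\qquad \frac{2\eta}{b(t)}\frac{dz}{dt}=R,$$ where $P=-2x(y-1)yz(x-\eta)(2x-2y+1-\eta)-2(2\alpha_0+2\alpha_1+4\alpha_2+\alpha_3+\alpha_4)x^3y-2(\alpha_0+\alpha_1)xy^3+(5\alpha_0+5\alpha_1+6\alpha_2+\alpha_3+\alpha_4)x^2y^2-\{5\alpha_0+5\alpha_1+6\alpha_2+2\alpha_3-3(2\alpha_0+2\alpha_1+4\alpha_2+\alpha_3+\alpha_4)\eta\}x^2y+\{3(\alpha_0+\alpha_1)-(4\alpha_0+6\alpha_1+6\alpha_2+\alpha_3+\alpha_4)\eta\}xy^2+x^4+2(\alpha_0+\alpha_1+2\alpha_2+\alpha_3-\eta)x^3+2\alpha_1\eta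 y^3+\{(\alpha_0+\alpha_1+2\alpha_2+\alpha_3)(\eta^2-3\eta+1)+\alpha_4\eta^2\}x^2+\alpha_1(\eta-3)\eta y^2+\{-(\alpha_0+\alpha_1)+2(2\alpha_0+3\alpha_1+3\alpha_2+\alpha_3)\eta-(2\alpha_0+2\alpha_1+4\alpha_2+\alpha_3+\alpha_4)\eta^2\}xy+(\alpha_0+\alpha_1+2\alpha_2+\alpha_3)(\eta-1)\eta x-\alpha_1(\eta-1)\eta y$, $Q=2x(y-1)yz(x-\eta)(2x-2y+1-\eta)-2(\alpha_3+\alpha_4)x^3y-2(\alpha_0+\alpha_1+4\alpha_2+2\alpha_3+2\alpha_4)xy^3+(\alpha_0+\alpha_1+6\alpha_2+5\alpha_3+5\alpha_4)x^2y^2+\{-(\alpha_0+\alpha_1+6\alpha_2+4\alpha_3+6\alpha_4)+3(\alpha_3+\alpha_4)\eta\}x^2y+\{3(\alpha_0+\alpha_1+4\alpha_2+2\alpha_3+2\alpha_4)-(2\alpha_0+6\alpha_2+5\alpha_3+5\alpha_4)\eta\}xy^2+y^4+2\alpha_4x^3+2\{(\alpha_0+2\alpha_2+\alpha_3+\alpha_4)\eta-1\}y^3-\alpha_4(3\eta-1)x^2+\{1-3(\alpha_0+2\alpha_2+\alpha_3+\alpha_4)\eta+(\alpha_0+2\alpha_2+\alpha_3+\alpha_4)\eta^2\}y^2+\{-(\alpha_0+\alpha_1+4\alpha_2+2\alpha_3+2\alpha_4)+2(\alpha_0+3\alpha_2+2\alpha_3+3\alpha_4)\eta-(\alpha_3+\alpha_4)\eta^2\}xy+\alpha_4(\eta-1)\eta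 x-(\alpha_0+2\alpha_2+\alpha_3+\alpha_4)(\eta-1)\eta y$, $R=(2x-2y+1-\eta)\{2x^2y+2xy^2-x^2-\eta y^2-2(\eta+1)xy+\eta(x+y)\}z^2+z\big[-2(\alpha_3+\alpha_4)x^3+2(\alpha_0+\alpha_1)y^3+2(\alpha_0+\alpha_1+6\alpha_2+2\alpha_3+2\alpha_4)x^2y-2(2\alpha_0+2\alpha_1+6\alpha_2+\alpha_3+\alpha_4)xy^2+\{-(\alpha_0+\alpha_1+6\alpha_2+4\alpha_3)+3(\alpha_3+\alpha_4)\eta\}x^2+\{-3(\alpha_0+\alpha_1)+(4\alpha_0+6\alpha_2+\alpha_3+\alpha_4)\eta\}y^2-4\{-(\alpha_0+\alpha_1+3\alpha_2+\alpha_3)+(\alpha_0+3\alpha_2+\alpha_3+\alpha_4)\eta\}xy+\{-(\alpha_0+\alpha_1+4\alpha_2+2\alpha_3)+2(\alpha_0+3\alpha_2+2\alpha_3)\eta-(\alpha_3+\alpha_4)\eta^2\}x+\{\alpha_0+\alpha_1-2(2\alpha_0+3\alpha_2+\alpha_3)\eta+(2\alpha_0+4\alpha_2+\alpha_3+\alpha_4)\eta^2\}y-(\alpha_0+2\alpha_2+\alpha_3)(\eta-1)\eta\big]+\alpha_2\big[(\alpha_0+\alpha_1+2\alpha_2-\alpha_3-\alpha_4)x^2+(\alpha_0+\alpha_1-2\alpha_2-\alpha_3-\alpha_4)y^2-2(\alpha_0+\alpha_1-\alpha_3-\alpha_4)xy+\{\alpha_0+\alpha_1-2\alpha_3-(2\alpha_0+2\alpha_2-\alpha_3-\alpha_4)\eta\}x+\{-\alpha_0-\alpha_1+2\alpha_2+2\alpha_3+(2\alpha_0-\alpha_3-\alpha_4)\eta\}y+(\eta-1)(\alpha_2+\alpha_3+(\alpha_0+\alpha_2)\eta)\big]$.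 *)

(* Defs.v *)
From HB Require Import structures.
From mathcomp Require Import all_boot all_order all_algebra.
From mathcomp Require Import reals complex.
From mathcomp Require Import mpoly.
From mathcomp Require Import ring.
Set Implicit Arguments.
Unset Strict Implicit.
Unset Printing Implicit Defensive.
Import GRing.Theory.
Local Open Scope ring_scope.

Local Notation "x %:F" := (@FracField.tofrac _ x) : ring_scope.

(* The field K(t) of rational functions in t, with K embedded as constants. *)
Definition ratfun (K : fieldType) : fieldType := {fraction {poly K}}.

Definition ratfun_const (K : fieldType) (c : K) : ratfun K := (c%:P)%:F.

Section RatfunDeriv.
Variable K : fieldType.
Local Open Scope quotient_scope.

(* d/dt on K(t), by the quotient rule applied to the canonical representative;
   ratfun_deriv_quot shows that any other representative gives the same. *)
Definition ratfun_deriv (f : ratfun K) : ratfun K :=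
  let n := \n_(repr f) in
  let d := \d_(repr f) in
  (n^`() * d - n * d^`())%:F / (d ^+ 2)%:F.

Lemma ratfun_numden (f : ratfun K) : f = (\n_(repr f))%:F / (\d_(repr f))%:F.
Proof.
have d0 := denom_ratioP (repr f); set d := \d_(repr f) in d0 *.
have dF0 : d%:F != 0 :> {fraction {poly K}} by rewrite tofrac_eq0.
apply: (mulIf dF0); rewrite divfK // -[X in X * _ = _]reprK.
unlock FracField.tofrac; rewrite -[LHS]FracField.pi_mul.
apply/eqmodP; rewrite /= FracField.equivfE /FracField.mulf.
by rewrite !numden_Ratio ?oner_neq0 ?mulr1 // mulrC.
Qed.

Lemma ratfun_deriv_quot (p q : {poly K}) : q != 0 ->
  ratfun_deriv (p%:F / q%:F) = (p^`() * q - p * q^`())%:F / (q ^+ 2)%:F.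
Proof.
move=> q0; rewrite /ratfun_deriv; set f := p%:F / q%:F.
have fE := ratfun_numden f; have d0 := denom_ratioP (repr f).
set n := \n_(repr f) in fE *; set d := \d_(repr f) in d0 fE *.
have tF0 (r : {poly K}) : r != 0 -> r%:F != 0 by rewrite tofrac_eq0.
have /eqP E : p * d == n * q.
  by rewrite -tofrac_eq !tofracM -(eqr_div _ _ (tF0 _ q0) (tF0 _ d0)) -fE.
apply/eqP; rewrite eqr_div ?tF0 ?expf_neq0 // -!tofracM tofrac_eq; apply/eqP.
have E' : p^`() * d + p * d^`() = n^`() * q + n * q^`().
  by rewrite -!derivM E.
have -> : (n^`() * d - n * d^`()) * q ^+ 2 =
  d * q * (n^`() * q + n * q^`()) - d * q^`() * (n * q) - q * d^`() * (n * q).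
  by ring.
by rewrite -E' -E; ring.
Qed.

Lemma ratfun_deriv_const (c : K) : ratfun_deriv (ratfun_const c) = 0.
Proof.
rewrite /ratfun_const -[_%:F]divr1 -[1 in X in _ / X]tofrac1.
by rewrite ratfun_deriv_quot ?oner_neq0 // !derivC mul0r mulr0 subr0 tofrac0 mul0r.
Qed.

End RatfunDeriv.

Section PolynomialSystem.
Variables (K : fieldType) (n : nat).
Implicit Types (V : 'I_n -> {mpoly (ratfun K)[n]}) (f : {mpoly (ratfun K)[n]}).

(* Derivative of f along dX_i/dt = V i; the coefficients of f, which are
   rational functions of t, are differentiated too. *)
Definition system_deriv V f : {mpoly (ratfun K)[n]} :=
  map_mpoly (@ratfun_deriv K) f + \sum_(i < n) V i * f^`M(i).

Definition invariant_divisor V f : Prop :=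
  exists g : {mpoly (ratfun K)[n]}, system_deriv V f = f * g.

Lemma system_derivX V (i : 'I_n) : system_deriv V 'X_i = V i.
Proof.
rewrite /system_deriv /map_mpoly /mmap msuppX big_seq1 mcoeffX eqxx /=.
have -> : @ratfun_deriv K 1 = 0.
  by rewrite -(ratfun_deriv_const (1 : K)) /ratfun_const polyC1 tofrac1.
rewrite mpolyC0 mul0r add0r (bigD1 i) //= big1 => [|j ji].
  have UU0 : (U_(i) - U_(i))%MM = 0%MM :> 'X_{1..n}.
    by apply/mnmP => k; rewrite mnmBE subnn mnm0E.
  by rewrite mderivX mnm1E eqxx scale1r UU0 mpolyX0 mulr1 addr0.
by rewrite mderivX mnm1E eq_sym (negPf ji) scale0r mulr0.
Qed.

End PolynomialSystem.

Section D4Polynomials.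
Variables (A : comNzRingType) (eta a0 a1 a2 a3 a4 x y z : A).

Definition D4_P : A :=
  - 2 * x * (y - 1) * y * z * (x - eta) * (2 * x - 2 * y + 1 - eta)
  - 2 * (2 * a0 + 2 * a1 + 4 * a2 + a3 + a4) * x ^+ 3 * y
  - 2 * (a0 + a1) * x * y ^+ 3
  + (5 * a0 + 5 * a1 + 6 * a2 + a3 + a4) * x ^+ 2 * y ^+ 2
  - (5 * a0 + 5 * a1 + 6 * a2 + 2 * a3 - 3 * (2 * a0 + 2 * a1 + 4 * a2 + a3
      + a4) * eta) * x ^+ 2 * y
  + (3 * (a0 + a1) - (4 * a0 + 6 * a1 + 6 * a2 + a3 + a4) * eta) *
      x * y ^+ 2
  + x ^+ 4
  + 2 * (a0 + a1 + 2 * a2 + a3 - eta) * x ^+ 3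
  + 2 * a1 * eta * y ^+ 3
  + ((a0 + a1 + 2 * a2 + a3) * (eta ^+ 2 - 3 * eta + 1) + a4 * eta ^+ 2) *
      x ^+ 2
  + a1 * (eta - 3) * eta * y ^+ 2
  + (- (a0 + a1) + 2 * (2 * a0 + 3 * a1 + 3 * a2 + a3) * eta - (2 * a0 +
      2 * a1 + 4 * a2 + a3 + a4) * eta ^+ 2) * x * y
  + (a0 + a1 + 2 * a2 + a3) * (eta - 1) * eta * x
  - a1 * (eta - 1) * eta * y.

Definition D4_Q : A :=
  2 * x * (y - 1) * y * z * (x - eta) * (2 * x - 2 * y + 1 - eta)
  - 2 * (a3 + a4) * x ^+ 3 * y
  - 2 * (a0 + a1 + 4 * a2 + 2 * a3 + 2 * a4) * x * y ^+ 3
  + (a0 + a1 + 6 * a2 + 5 * a3 + 5 * a4) * x ^+ 2 * y ^+ 2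
  + (- (a0 + a1 + 6 * a2 + 4 * a3 + 6 * a4) + 3 * (a3 + a4) * eta) *
      x ^+ 2 * y
  + (3 * (a0 + a1 + 4 * a2 + 2 * a3 + 2 * a4) - (2 * a0 + 6 * a2 + 5 * a3 +
      5 * a4) * eta) * x * y ^+ 2
  + y ^+ 4
  + 2 * a4 * x ^+ 3
  + 2 * ((a0 + 2 * a2 + a3 + a4) * eta - 1) * y ^+ 3
  - a4 * (3 * eta - 1) * x ^+ 2
  + (1 - 3 * (a0 + 2 * a2 + a3 + a4) * eta + (a0 + 2 * a2 + a3 + a4) *
      eta ^+ 2) * y ^+ 2
  + (- (a0 + a1 + 4 * a2 + 2 * a3 + 2 * a4) + 2 * (a0 + 3 * a2 + 2 * a3 +
      3 * a4) * eta - (a3 + a4) * eta ^+ 2) * x * y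
  + a4 * (eta - 1) * eta * x
  - (a0 + 2 * a2 + a3 + a4) * (eta - 1) * eta * y.

Definition D4_R : A :=
  (2 * x - 2 * y + 1 - eta) * (2 * x ^+ 2 * y + 2 * x * y ^+ 2 - x ^+ 2 -
      eta * y ^+ 2 - 2 * (eta + 1) * x * y + eta * (x + y)) * z ^+ 2
  + z * (- 2 * (a3 + a4) * x ^+ 3
      + 2 * (a0 + a1) * y ^+ 3
      + 2 * (a0 + a1 + 6 * a2 + 2 * a3 + 2 * a4) * x ^+ 2 * y
      - 2 * (2 * a0 + 2 * a1 + 6 * a2 + a3 + a4) * x * y ^+ 2
      + (- (a0 + a1 + 6 * a2 + 4 * a3) + 3 * (a3 + a4) * eta) * x ^+ 2
      + (- 3 * (a0 + a1) + (4 * a0 + 6 * a2 + a3 + a4) * eta) * y ^+ 2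
      - 4 * (- (a0 + a1 + 3 * a2 + a3) + (a0 + 3 * a2 + a3 + a4) * eta) *
          x * y
      + (- (a0 + a1 + 4 * a2 + 2 * a3) + 2 * (a0 + 3 * a2 + 2 * a3) * eta -
          (a3 + a4) * eta ^+ 2) * x
      + (a0 + a1 - 2 * (2 * a0 + 3 * a2 + a3) * eta + (2 * a0 + 4 * a2 + a3
          + a4) * eta ^+ 2) * y
      - (a0 + 2 * a2 + a3) * (eta - 1) * eta)
  + a2 * ((a0 + a1 + 2 * a2 - a3 - a4) * x ^+ 2
      + (a0 + a1 - 2 * a2 - a3 - a4) * y ^+ 2
      - 2 * (a0 + a1 - a3 - a4) * x * y
      + (a0 + a1 - 2 * a3 - (2 * a0 + 2 * a2 - a3 - a4) * eta) * x
      + (- a0 - a1 + 2 * a2 + 2 * a3 + (2 * a0 - a3 - a4) * eta) * y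
      + (eta - 1) * (a2 + a3 + (a0 + a2) * eta)).

End D4Polynomials.

Section D4System.
Variable K : fieldType.
Local Notation pol := {mpoly (ratfun K)[3]}.

Definition varx : pol := 'X_(inord 0).
Definition vary : pol := 'X_(inord 1).
Definition varz : pol := 'X_(inord 2).

Definition cst (c : K) : pol := (ratfun_const c)%:MP.

(* The right-hand sides of the system solved for dx/dt, dy/dt, dz/dt; note the
   minus sign in the equation for y. *)
Definition D4_system (eta : K) (b : ratfun K) (a0 a1 a2 a3 a4 : K)
    (i : 'I_3) : pol :=
  let rhs (F : pol -> pol -> pol -> pol -> pol -> pol ->
               pol -> pol -> pol -> pol) :=
    F (cst eta) (cst a0) (cst a1) (cst a2) (cst a3) (cst a4)
      varx vary varz in
  (b / (2 * ratfun_const eta)) *: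
    [:: rhs (@D4_P pol); - rhs (@D4_Q pol); rhs (@D4_R pol)]`_i.

Lemma D4_systemE (eta : K) (b : ratfun K) (a0 a1 a2 a3 a4 : K) :
    (2 : ratfun K) != 0 -> eta != 0 -> b != 0 ->
  let V := D4_system eta b a0 a1 a2 a3 a4 in
  let rhs (F : pol -> pol -> pol -> pol -> pol -> pol ->
               pol -> pol -> pol -> pol) :=
    F (cst eta) (cst a0) (cst a1) (cst a2) (cst a3) (cst a4)
      varx vary varz in
  let c := 2 * ratfun_const eta / b in
  [/\ c *: system_deriv V varx = rhs (@D4_P pol),
      - c *: system_deriv V vary = rhs (@D4_Q pol)
    & c *: system_deriv V varz = rhs (@D4_R pol)].
Proof.
move=> two0 eta0 b0 V rhs c.
have e0 : ratfun_const eta != 0 by rewrite /ratfun_const tofrac_eq0 polyC_eq0.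
have cK : c * (b / (2 * ratfun_const eta)) = 1.
  have fK (F : fieldType) (u v : F) : u != 0 -> v != 0 -> u / v * (v / u) = 1.
    by move=> u0 v0; rewrite mulrA divfK // mulfV.
  exact: (fK _ _ _ (mulf_neq0 two0 e0) b0).
have dE (i : 'I_3) : system_deriv V 'X_i = V i by exact: system_derivX.
have VE (i : 'I_3) : V i = (b / (2 * ratfun_const eta)) *:
  [:: rhs (@D4_P pol); - rhs (@D4_Q pol); rhs (@D4_R pol)]`_i by [].
clearbody V rhs; rewrite /varx /vary /varz !dE !VE !inordK //.
have cZ (v : pol) : c *: ((b / (2 * ratfun_const eta)) *: v) = v.
  by rewrite scalerA cK scale1r.
split; [exact: cZ | | exact: cZ].
by rewrite scaleNr -[RHS]opprK; congr (- _); apply: cZ.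
Qed.

End D4System.

(* Main.v *)
Require Import Defs.
From HB Require Import structures.
From mathcomp Require Import all_boot all_order all_algebra.
From mathcomp Require Import reals complex.
From mathcomp Require Import mpoly.
From mathcomp Require Import ring.
Import GRing.Theory.
Local Open Scope ring_scope.

(** The derivative along the system is a derivation, so a product of invariant
    divisors is again an invariant divisor ([invariant_divisorM]). Hence the two
    quadratic divisors may be treated one linear factor at a time: x and y for
    [f_2], x - eta and y - 1 for [f_0]. For a linear form [X_i - c] with
    constant c the derivative is just the i-th right-hand side, and the question
    becomes whether P, Q or R is divisible by that form.

    For z, x and y the term of R, P, Q that is free of the variable carries the
    factor [alpha_2], [alpha_1], [alpha_4] respectively, so it disappears when
    that parameter does. For x - eta and y - 1 the divisibility is less
    visible: once [alpha_0 = alpha_3 = 0] and [alpha_4 = alpha_1], the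
    normalization of the parameters becomes [2 alpha_1 + 2 alpha_2 = 1], and
    this is what makes the z-free terms of degree 0 in the parameters (such as
    [x^4] in P and [y^4] in Q) cancel against those of degree 1 at [x = eta],
    respectively at [y = 1] ([D4_P_factor_sub], [D4_Q_factor_sub]).

    The derivation property is proved first on the coefficient field of
    rational functions of t, by the quotient rule, and then transferred to
    polynomials. *)

(** * Derivations on rational functions and on polynomials over them *)

Lemma sum_leibniz (A : comNzRingType) (I : finType) (v df dg : I -> A)
    (f g : A) :
  \sum_i v i * (df i * g + f * dg i) =
  (\sum_i v i * df i) * g + f * (\sum_i v i * dg i).
Proof.
rewrite mulr_suml mulr_sumr -big_split.
by apply: eq_bigr => i _; rewrite mulrDr mulrA mulrCA.
Qed.

Section Derivation.
Variable K : fieldType.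
Local Notation "x %:F" := (@FracField.tofrac _ x) : ring_scope.
Local Notation delta := (@ratfun_deriv K).

Lemma ratfun_quotP (f : ratfun K) :
  exists p : {poly K}, exists2 q, q != 0 & f = p%:F / q%:F.
Proof.
exists (\n_(repr f))%qT, (\d_(repr f))%qT; first exact: denom_ratioP.
exact: ratfun_numden.
Qed.

Lemma ratfun_derivD (f g : ratfun K) : delta (f + g) = delta f + delta g.
Proof.
have [p [q q0 ->]] := ratfun_quotP f; have [r [s s0 ->]] := ratfun_quotP g.
have tF0 (u : {poly K}) : u != 0 -> u%:F != 0 by rewrite tofrac_eq0.
rewrite (addf_div _ _ (tF0 _ q0) (tF0 _ s0)) -!tofracM -tofracD.
rewrite !ratfun_deriv_quot ?mulf_neq0 //.
rewrite (addf_div _ _ (tF0 _ (expf_neq0 2 q0)) (tF0 _ (expf_neq0 2 s0))).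
rewrite -!tofracM -tofracD -exprMn.
by congr (_%:F / _); rewrite derivD !derivM; ring.
Qed.

Lemma ratfun_derivM (f g : ratfun K) :
  delta (f * g) = delta f * g + f * delta g.
Proof.
have [p [q q0 ->]] := ratfun_quotP f; have [r [s s0 ->]] := ratfun_quotP g.
have tF0 (u : {poly K}) : u != 0 -> u%:F != 0 by rewrite tofrac_eq0.
have q2s0 : q ^+ 2 * s != 0 by rewrite mulf_neq0 ?expf_neq0.
have qs20 : q * s ^+ 2 != 0 by rewrite mulf_neq0 ?expf_neq0.
have qs0 : (q * s) ^+ 2 != 0 by rewrite expf_neq0 ?mulf_neq0.
rewrite mulf_div -!tofracM !ratfun_deriv_quot ?mulf_neq0 //.
rewrite !derivM !mulf_div -!tofracM.
rewrite (addf_div _ _ (tF0 _ q2s0) (tF0 _ qs20)) -!tofracM -tofracD.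
apply/eqP; rewrite (eqr_div _ _ (tF0 _ qs0) (tF0 _ (mulf_neq0 q2s0 qs20))).
by rewrite -!tofracM; apply/eqP; congr (_%:F); ring.
Qed.

Lemma ratfun_deriv_zmod : zmod_morphism delta.
Proof.
move=> f g; apply/eqP.
by rewrite eq_sym subr_eq -ratfun_derivD subrK.
Qed.

HB.instance Definition _ :=
  GRing.isZmodMorphism.Build (ratfun K) (ratfun K) delta ratfun_deriv_zmod.

Variable n : nat.
Implicit Types (V : 'I_n -> {mpoly (ratfun K)[n]}).
Implicit Types (f g : {mpoly (ratfun K)[n]}).

(** Coefficients of a product are convolutions, so the Leibniz rule for the
    coefficients gives one for the polynomials. *)
Lemma map_ratfun_derivM f g :
  map_mpoly delta (f * g) = map_mpoly delta f * g + f * map_mpoly delta g.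
Proof.
apply/mpolyP => m.
rewrite mcoeffD mcoeff_map_mpoly !mcoeffM raddf_sum -big_split.
by apply: eq_bigr => k _; rewrite !mcoeff_map_mpoly; apply: ratfun_derivM.
Qed.

Lemma system_derivM V f g :
  system_deriv V (f * g) = system_deriv V f * g + f * system_deriv V g.
Proof.
have -> : system_deriv V (f * g) =
    map_mpoly delta (f * g) + \sum_i V i * (f^`M(i) * g + f * g^`M(i)).
  by congr (_ + _); apply: eq_bigr => i _; rewrite mderivM.
by rewrite sum_leibniz map_ratfun_derivM mulrDl mulrDr addrACA.
Qed.

Lemma system_derivB V f g :
  system_deriv V (f - g) = system_deriv V f - system_deriv V g.
Proof.
have -> : system_deriv V (f - g) =
    map_mpoly delta (f - g) + \sum_i (V i * f^`M(i) - V i * g^`M(i)).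
  by congr (_ + _); apply: eq_bigr => i _; rewrite raddfB mulrBr.
by rewrite sumrB raddfB opprD addrACA.
Qed.

Lemma system_deriv_const V (c : K) : system_deriv V (ratfun_const c)%:MP = 0.
Proof.
rewrite /system_deriv map_mpolyC [X in X%:MP]ratfun_deriv_const mpolyC0 add0r.
by apply: big1 => i _; rewrite mderivC mulr0.
Qed.

Lemma invariant_divisorM V f g :
  invariant_divisor V f -> invariant_divisor V g -> invariant_divisor V (f * g).
Proof.
move=> [u fu] [v gv]; exists (u + v).
by rewrite system_derivM fu gv; ring.
Qed.

(** The shift by a constant does not contribute to the derivative, so it is
    enough that one component of the vector field is divisible. *)
Lemma invariant_divisor_linear V (i : 'I_n) (c : K) g :
  V i = ('X_i - (ratfun_const c)%:MP) * g ->
  invariant_divisor V ('X_i - (ratfun_const c)%:MP).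
Proof.
move=> Vi; exists g.
by rewrite system_derivB system_derivX system_deriv_const subr0.
Qed.

End Derivation.

(** * Linear factors of the right-hand sides *)

Section Factors.
Variables (A : comNzRingType) (eta a0 a1 a2 a3 a4 x y z : A).

Lemma D4_P_factor :
  {g | D4_P eta a0 0 a2 a3 a4 x y z = x * g}.
Proof.
exists (- 2 * (y - 1) * y * z * (x - eta) * (2 * x - 2 * y + 1 - eta)
  - 2 * (2 * a0 + 4 * a2 + a3 + a4) * x ^+ 2 * y
  - 2 * a0 * y ^+ 3
  + (5 * a0 + 6 * a2 + a3 + a4) * x * y ^+ 2
  - (5 * a0 + 6 * a2 + 2 * a3 - 3 * (2 * a0 + 4 * a2 + a3 + a4) * eta) * x * y
  + (3 * a0 - (4 * a0 + 6 * a2 + a3 + a4) * eta) * y ^+ 2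
  + x ^+ 3
  + 2 * (a0 + 2 * a2 + a3 - eta) * x ^+ 2
  + ((a0 + 2 * a2 + a3) * (eta ^+ 2 - 3 * eta + 1) + a4 * eta ^+ 2) * x
  + (- a0 + 2 * (2 * a0 + 3 * a2 + a3) * eta
     - (2 * a0 + 4 * a2 + a3 + a4) * eta ^+ 2) * y
  + (a0 + 2 * a2 + a3) * (eta - 1) * eta).
by rewrite /D4_P; ring.
Qed.

Lemma D4_Q_factor :
  {g | D4_Q eta a0 a1 a2 a3 0 x y z = y * g}.
Proof.
exists (2 * x * (y - 1) * z * (x - eta) * (2 * x - 2 * y + 1 - eta)
  - 2 * a3 * x ^+ 3
  - 2 * (a0 + a1 + 4 * a2 + 2 * a3) * x * y ^+ 2
  + (a0 + a1 + 6 * a2 + 5 * a3) * x ^+ 2 * y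
  + (- (a0 + a1 + 6 * a2 + 4 * a3) + 3 * a3 * eta) * x ^+ 2
  + (3 * (a0 + a1 + 4 * a2 + 2 * a3) - (2 * a0 + 6 * a2 + 5 * a3) * eta) * x * y
  + y ^+ 3
  + 2 * ((a0 + 2 * a2 + a3) * eta - 1) * y ^+ 2
  + (1 - 3 * (a0 + 2 * a2 + a3) * eta + (a0 + 2 * a2 + a3) * eta ^+ 2) * y
  + (- (a0 + a1 + 4 * a2 + 2 * a3) + 2 * (a0 + 3 * a2 + 2 * a3) * eta
     - a3 * eta ^+ 2) * x
  - (a0 + 2 * a2 + a3) * (eta - 1) * eta).
by rewrite /D4_Q; ring.
Qed.

Lemma D4_R_factor :
  {g | D4_R eta a0 a1 0 a3 a4 x y z = z * g}.
Proof.
rewrite /D4_R mul0r addr0 [z ^+ 2]expr2 [_ * (z * z)]mulrCA -mulrDr.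
by eexists.
Qed.

(** Replacing [2 * a2] by [1 - 2 * a1] turns P into a polynomial in x over the
    ring generated by eta, a1, y and z. The terms containing z already have the
    factor x - eta; for the others the cofactor comes from synthetic division
    by x - eta, whose remainder vanishes. *)
Lemma D4_P_factor_sub : 2 * a1 + 2 * a2 = 1 ->
  {g | D4_P eta 0 a1 a2 0 a1 x y z = (x - eta) * g}.
Proof.
move=> a12.
exists (- 2 * x * (y - 1) * y * z * (2 * x - 2 * y + 1 - eta)
  + x ^+ 3 + (- 2 * (2 - a1) * y + 2 * (1 - a1) - eta) * x ^+ 2
  + (3 * y ^+ 2 + (- (3 - a1) + (2 - a1) * eta) * y + (1 - a1) * (1 - eta)) * x
  - a1 * y * (y - 1) * (2 * y - 1 + eta)).
(* P involves a2 only through 2 * a2, so in this form the hypothesis eliminates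
   a2 by rewriting, without a division by 2. *)
have -> : D4_P eta 0 a1 a2 0 a1 x y z =
  - 2 * x * (y - 1) * y * z * (x - eta) * (2 * x - 2 * y + 1 - eta)
  - 2 * (2 * (2 * a2) + 3 * a1) * x ^+ 3 * y
  - 2 * a1 * x * y ^+ 3
  + (6 * a1 + 3 * (2 * a2)) * x ^+ 2 * y ^+ 2
  - (5 * a1 + 3 * (2 * a2) - 3 * (3 * a1 + 2 * (2 * a2)) * eta) * x ^+ 2 * y
  + (3 * a1 - (7 * a1 + 3 * (2 * a2)) * eta) * x * y ^+ 2
  + x ^+ 4
  + 2 * (a1 + 2 * a2 - eta) * x ^+ 3
  + 2 * a1 * eta * y ^+ 3
  + ((a1 + 2 * a2) * (eta ^+ 2 - 3 * eta + 1) + a1 * eta ^+ 2) * x ^+ 2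
  + a1 * (eta - 3) * eta * y ^+ 2
  + (- a1 + (6 * a1 + 3 * (2 * a2)) * eta - (3 * a1 + 2 * (2 * a2)) * eta ^+ 2)
      * x * y
  + (a1 + 2 * a2) * (eta - 1) * eta * x
  - a1 * (eta - 1) * eta * y by rewrite /D4_P; ring.
by rewrite (canRL (addKr _) a12); ring.
Qed.

(** The same division works for Q, now as a polynomial in y with root 1. *)
Lemma D4_Q_factor_sub : 2 * a1 + 2 * a2 = 1 ->
  {g | D4_Q eta 0 a1 a2 0 a1 x y z = (y - 1) * g}.
Proof.
move=> a12.
exists (2 * x * y * z * (x - eta) * (2 * x - 2 * y + 1 - eta)
  + y ^+ 3 + (- 2 * (2 - a1) * x + 2 * (1 - a1) * eta - 1) * y ^+ 2
  + (3 * x ^+ 2 + ((2 - a1) - (3 - a1) * eta) * x + (1 - a1) * (eta - 1) * eta)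
      * y
  - a1 * x * (x - eta) * (2 * x + 1 - eta)).
have -> : D4_Q eta 0 a1 a2 0 a1 x y z =
  2 * x * (y - 1) * y * z * (x - eta) * (2 * x - 2 * y + 1 - eta)
  - 2 * a1 * x ^+ 3 * y
  - 2 * (3 * a1 + 2 * (2 * a2)) * x * y ^+ 3
  + (6 * a1 + 3 * (2 * a2)) * x ^+ 2 * y ^+ 2
  + (- (7 * a1 + 3 * (2 * a2)) + 3 * a1 * eta) * x ^+ 2 * y
  + (3 * (3 * a1 + 2 * (2 * a2)) - (3 * (2 * a2) + 5 * a1) * eta) * x * y ^+ 2
  + y ^+ 4
  + 2 * a1 * x ^+ 3
  + 2 * ((2 * a2 + a1) * eta - 1) * y ^+ 3
  - a1 * (3 * eta - 1) * x ^+ 2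
  + (1 - 3 * (2 * a2 + a1) * eta + (2 * a2 + a1) * eta ^+ 2) * y ^+ 2
  + (- (3 * a1 + 2 * (2 * a2)) + (6 * a1 + 3 * (2 * a2)) * eta - a1 * eta ^+ 2)
      * x * y
  + a1 * (eta - 1) * eta * x
  - (2 * a2 + a1) * (eta - 1) * eta * y by rewrite /D4_Q; ring.
by rewrite (canRL (addKr _) a12); ring.
Qed.

End Factors.

(** * The system *)

Section System.
Variable K : fieldType.
Local Notation pol := {mpoly (ratfun K)[3]}.

HB.instance Definition _ := GRing.RMorphism.copy (@cst K)
  (@mpolyC 3 (ratfun K) \o @FracField.tofrac {poly K} \o @polyC K).

Variables (eta : K) (b : ratfun K) (a0 a1 a2 a3 a4 : K).
Local Notation V := (D4_system eta b a0 a1 a2 a3 a4).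
Local Notation rhs F :=
  (F (cst eta) (cst a0) (cst a1) (cst a2) (cst a3) (cst a4)
     (varx K) (vary K) (varz K)).

(** The common factor b / (2 eta) goes into the cofactor, and so does the sign
    of the equation for y below. *)
Lemma D4_invariant_x (c : K) :
  {g | rhs (@D4_P pol) = (varx K - cst c) * g} ->
  invariant_divisor V (varx K - cst c).
Proof.
move=> [g Pg]; have VE : V (inord 0) =
    (varx K - cst c) * ((b / (2 * ratfun_const eta)) *: g).
  by rewrite /D4_system inordK // [nth _ _ _]Pg -scalerAr.
exact: invariant_divisor_linear VE.
Qed.

Lemma D4_invariant_y (c : K) :
  {g | rhs (@D4_Q pol) = (vary K - cst c) * g} ->
  invariant_divisor V (vary K - cst c).
Proof.
move=> [g Qg]; have VE : V (inord 1) =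
    (vary K - cst c) * - ((b / (2 * ratfun_const eta)) *: g).
  rewrite /D4_system inordK // [nth _ _ _](congr1 -%R Qg).
  by rewrite scalerN mulrN -scalerAr.
exact: invariant_divisor_linear VE.
Qed.

Lemma D4_invariant_z : {g | rhs (@D4_R pol) = varz K * g} ->
  invariant_divisor V (varz K).
Proof.
move=> [g Rg]; exists ((b / (2 * ratfun_const eta)) *: g).
by rewrite system_derivX /D4_system inordK // [nth _ _ _]Rg -scalerAr.
Qed.

End System.

Theorem proposition5p3 (R : realType) (eta : R[i]) (b : ratfun R[i])
    (alpha0 alpha1 alpha2 alpha3 alpha4 : R[i])
    (eta_neq0 : eta != 0) (b_neq0 : b != 0)
    (alpha_sum : alpha0 + alpha1 + 2 * alpha2 + alpha3 + alpha4 = 1)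
    (alpha41 : alpha4 = alpha1) (alpha03 : alpha0 = alpha3) :
  let beta0 := alpha3 in
  let beta1 := alpha2 in
  let beta2 := alpha1 in
  let V := D4_system eta b alpha0 alpha1 alpha2 alpha3 alpha4 in
  let x := varx R[i] in
  let y := vary R[i] in
  let z := varz R[i] in
  [/\ beta0 + beta1 + beta2 = 1 / 2,
      beta0 = 0 -> invariant_divisor V ((x - cst eta) * (y - 1)),
      beta1 = 0 -> invariant_divisor V z
    & beta2 = 0 -> invariant_divisor V (x * y)].
Proof.
move=> beta0 beta1 beta2 V x y z.
have beta_sum : 2 * (beta0 + beta1 + beta2) = 1.
  by rewrite -[RHS]alpha_sum alpha41 alpha03 /beta0 /beta1 /beta2; ring.
split.
- have two0 : (2 : R[i]) != 0 by rewrite Num.Theory.pnatr_eq0.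
  by apply: (mulfI two0); rewrite beta_sum mul1r mulfV.
- rewrite /beta0 => b00.
  have cst_sum : 2 * cst alpha1 + 2 * cst alpha2 = 1.
    have := congr1 (@cst R[i]) beta_sum; rewrite /beta0 b00 add0r.
    by rewrite addrC rmorphM rmorph_nat rmorphD rmorph1 mulrDr.
  rewrite -(rmorph1 (@cst R[i])); apply: invariant_divisorM.
    apply: D4_invariant_x; rewrite alpha41 alpha03 b00 rmorph0.
    exact: D4_P_factor_sub.
  apply: D4_invariant_y; rewrite alpha41 alpha03 b00 rmorph0 rmorph1.
  exact: D4_Q_factor_sub.
- rewrite /beta1 => b10; apply: D4_invariant_z.
  by rewrite b10 rmorph0; apply: D4_R_factor.
- rewrite /beta2 => b20.
  (* x and y are the linear forms x - 0 and y - 0. *)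
  rewrite -[x]subr0 -[y]subr0 -(rmorph0 (@cst R[i])).
  apply: invariant_divisorM.
    apply: D4_invariant_x; rewrite b20 rmorph0 subr0.
    exact: D4_P_factor.
  apply: D4_invariant_y; rewrite alpha41 b20 rmorph0 subr0.
  exact: D4_Q_factor.
Qed.
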